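(* Let $n\ge 2$, $r\ge1$, $p\mid r$, $d=r/p$, let $\xi\in\mathbb{C}$ be a primitive $p$-th root of unity, let $0\neq q\in\mathbb{C}$, let $v_0,\dots,v_{d-1}\in\mathbb{C}$ with $v_i^p\ne v_j^p$ for $i\ne j$, and let $u_1,\dots,u_r$ be defined by $u_j=\xi^kv_l$ if $j-1=lp+k$ ($0\le k\le p-1$, $0\le l\le d-1$), so that $(T_1-u_1)\cdots(T_1-u_r)=(T_1^p-v_0^p)\cdots(T_1^p-v_{d-1}^p)$. Suppose that the algebra $\mathcal{H}=\mathcal{H}_{r,1,n}(u_1,\dots,u_r,q)$ is semisimple. Then, up to some ordering of the $u_i$, one has $$\tau\circ\mathrm{shift}=1$$ on the simple $\mathcal{H}$-modules. That is, there is an ordering of the parameters $u_1,\dots,u_r$ as a family $(w_{i,j})_{0\le i\le p-1,\,0\le j\le d-1}$ such that, for the simple modules $V(\lambda)$ labelled with respect to this ordering, ${}^{\tau}V(\mathrm{shift}(\lambda))\cong V(\lambda)$ for every $r$-tuple $\lambda$ of Young diagrams of total size $n$.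
   Context: The cyclotomic Hecke algebra $\mathcal{H}_{r,1,n}(u_1,\dots,u_r,q)$ is the $\mathbb{C}$-algebra with generators $T_1,\dots,T_n$ and relations: $T_iT_j=T_jT_i$ if $|i-j|>1$; $T_iT_{i+1}T_i=T_{i+1}T_iT_{i+1}$ for $2\le i\le n-1$; $T_1T_2T_1T_2=T_2T_1T_2T_1$; $(T_1-u_1)\cdots(T_1-u_r)=0$; $(T_i-1)(T_i+q)=0$ for $2\le i\le n$. It has the algebra automorphism $\tau$ with $\tau(T_1)=\xi T_1$, $\tau(T_i)=T_i$ for $2\le i\le n$. For an $\mathcal{H}$-module $N$, the module ${}^{\tau}N$ has the same underlying vector space with action $h\circ m=\tau^{-1}(h)m$; this gives an action of $\tau$ on isomorphism classes of simple modules. Index $r$-tuples of Young diagrams as $\lambda=(\lambda^i_j)_{0\le i\le p-1,\,0\le j\le d-1}$ with $\sum_{i,j}|\lambda^i_j|=n$, the upper index being read modulo $p$. Ariki's shift operator is $\mathrm{shift}(\lambda)=(\lambda^{i+1}_j)$, i.e. the $(i,j)$ component of $\mathrm{shift}(\lambda)$ is $\lambda_j^{i+1}$; on modules, $\mathrm{shift}$ sends $V(\lambda)$ to $V(\mathrm{shift}(\lambda))$. A standard tableau $\mathbb{T}$ of shape $\lambda$ is a bijection from $\{1,\dots,n\}$ to the cells of $\lambda$ whose entries increase along rows and down columns of each $\lambda^i_j$. If $y$ lies in $\lambda^i_j$ in row $k$ and column $l$, put $a(\mathbb{T},y)=i$, $b(\mathbb{T},y)=j$, $c(\mathbb{T},y)=l-k$.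 Given an ordering $(w_{i,j})$ of $u_1,\dots,u_r$, $V(\lambda)$ denotes the Ariki–Koike simple module: it has a basis $\{v(\mathbb{T})\}$ indexed by the standard tableaux of shape $\lambda$, with $T_1v(\mathbb{T})=w_{a,b}\,v(\mathbb{T})$ for $a=a(\mathbb{T},1)$, $b=b(\mathbb{T},1)$, and more generally the elements $L_y=q^{1-y}T_yT_{y-1}\cdots T_2T_1T_2\cdots T_{y-1}T_y$ act by $L_yv(\mathbb{T})=w_{a(\mathbb{T},y),b(\mathbb{T},y)}\,q^{-c(\mathbb{T},y)}v(\mathbb{T})$ for $1\le y\le n$. When $\mathcal{H}$ is semisimple this determines $V(\lambda)$ up to isomorphism, and the $V(\lambda)$ form a complete set of pairwise non-isomorphic simple $\mathcal{H}$-modules.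
   Formalization: V(λ) is taken to be the simple module with a tableau basis on which, besides T_1 and the L_y, the T_i (i>1) also act by the Ariki–Koike seminormal formulas, because for q=1 the L_y action alone does not determine V(λ). *)

(* Defs.v *)
From HB Require Import structures.
From mathcomp Require Import all_boot all_order all_algebra.
From mathcomp Require Import generic_quotient ring_quotient.
From mathcomp Require Import boolp.
From mathcomp Require Import monalg.

Set Implicit Arguments.
Unset Strict Implicit.
Unset Printing Implicit Defensive.
Import GRing.Theory.
Local Open Scope ring_scope.
Local Open Scope quotient_scope.

Section FreeAlgebra.
Variables (K : comNzRingType) (X : choiceType).

Definition free_alg : Type := {malg K[{fmonom X}]}.
HB.instance Definition _ := GRing.Lalgebra.on free_alg.

Lemma free_alg_scalerAr (c : K) (x y : free_alg) : c *: (x * y) = x * (c *: y).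
Proof.
have cC (z : {malg K[{fmonom X}]}) : c%:MP * z = z * c%:MP.
  rewrite /GRing.mul /= fgmulUg fgmulgU; apply: eq_bigr => k _.
  by rewrite mulrC mul1m mulm1.
by rewrite -[LHS]mul_malgC -[c *: y]mul_malgC [LHS]mulrA cC -mulrA.
Qed.
HB.instance Definition _ :=
  GRing.Lalgebra_isAlgebra.Build K free_alg free_alg_scalerAr.

Definition free_gen (x : X) : free_alg := << fmu x >>.

Variables (B : algType K) (g : X -> B).

Definition free_word (m : {fmonom X}) : B := \prod_(x <- (m : seq X)) g x.

Lemma free_word_mmorphism : mmorphism free_word.
Proof.
by split=> [m1 m2|]; rewrite /free_word ?fmM ?big_cat // fm1 big_nil.
Qed.
HB.instance Definition _ :=
  isMultiplicative.Build {fmonom X} B free_word free_word_mmorphism.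

Definition free_lift (x : free_alg) : B := mmap (in_alg B) free_word x.

Lemma free_lift_zmod : zmod_morphism free_lift.
Proof. by move=> x y; rewrite /free_lift raddfB. Qed.
HB.instance Definition _ :=
  GRing.isZmodMorphism.Build free_alg B free_lift free_lift_zmod.

Lemma free_lift_monoid : monoid_morphism free_lift.
Proof.
suff [fM f1] : {morph free_lift : x y / x * y} * (free_lift 1 = 1).
  by split.
apply: commr_mmap_is_multiplicative => x m m'.
by rewrite /GRing.comm /= -scalerAl -scalerAr mul1r mulr1.
Qed.
HB.instance Definition _ :=
  GRing.isMonoidMorphism.Build free_alg B free_lift free_lift_monoid.

Lemma free_lift_scalable : scalable free_lift.
Proof. by move=> c x; rewrite /free_lift mmapZ /= -scalerAl mul1r. Qed.
HB.instance Definition _ :=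
  GRing.isScalable.Build K free_alg B *:%R free_lift free_lift_scalable.

Lemma free_lift_gen x : free_lift (free_gen x) = g x.
Proof. by rewrite /free_lift mmapU /= scale1r mul1r /free_word fmU big_seq1. Qed.

Lemma free_lift_uniq (f : {lrmorphism free_alg -> B}) :
  (forall x, f (free_gen x) = g x) -> f =1 free_lift.
Proof.
move=> fg a; rewrite [a]monalgE !raddf_sum; apply: eq_bigr => m _ /=.
rewrite [free_lift _]mmapU /=.
have -> : << a@_m *g m >> = a@_m *: (<< m >> : free_alg).
  by rewrite -[RHS]mul_malgC /GRing.mul /= fgmulUU mulr1 mul1m.
rewrite linearZ /= -scalerAl mul1r; congr (_ *: _).
case: m => s; elim: s => [|x s IHs].
  have -> : FMonom [::] = mone :> {fmonom X} by apply: val_inj; rewrite /= fm1.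
  by rewrite mmorph1 [LHS]rmorph1.
have -> : FMonom (x :: s) = mmul (fmu x) (FMonom s) :> {fmonom X}.
  by apply: val_inj; rewrite /= fmM fmU.
have -> : << mmul (fmu x) (FMonom s) >> = free_gen x * << FMonom s >> :> free_alg.
  by rewrite /GRing.mul /= fgmulUU mulr1.
by rewrite rmorphM mmorphM /= IHs fg /free_word fmU big_seq1.
Qed.

End FreeAlgebra.

Inductive two_sided_span (A : nzRingType) (S : A -> Prop) : A -> Prop :=
| Span0 : two_sided_span S 0
| SpanD a s b x :
    S s -> two_sided_span S x -> two_sided_span S (a * s * b + x).

Section TwoSidedSpan.
Variables (A : nzRingType) (S : A -> Prop).
Local Notation I := (two_sided_span S).

Lemma spanD x y : I x -> I y -> I (x + y).
Proof.
elim=> [|a s b z Ss _ IH] Iy; rewrite ?add0r // -addrA.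
exact: SpanD (IH Iy).
Qed.

Lemma spanMl c x : I x -> I (c * x).
Proof.
elim=> [|a s b z Ss _ IH]; first by rewrite mulr0; apply: Span0.
by rewrite mulrDr !mulrA; apply: SpanD.
Qed.

Lemma spanMr c x : I x -> I (x * c).
Proof.
elim=> [|a s b z Ss _ IH]; first by rewrite mul0r; apply: Span0.
by rewrite mulrDl -mulrA; apply: SpanD.
Qed.

Lemma spanN x : I x -> I (- x).
Proof. by rewrite -mulN1r; apply: spanMl. Qed.

Lemma span_gen s : S s -> I s.
Proof.
by move=> Ss; rewrite -[s]addr0 -[s]mulr1 -[s]mul1r; apply: SpanD (Span0 _).
Qed.

Lemma span_ker (B : nzRingType) (f : {rmorphism A -> B}) :
  (forall s, S s -> f s = 0) -> forall x, I x -> f x = 0.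
Proof.
move=> fS x; elim=> [|a s b z Ss _ IH]; first exact: rmorph0.
by rewrite rmorphD !rmorphM /= IH (fS _ Ss) mulr0 mul0r addr0.
Qed.

Definition in_span : A -> bool := fun x => `[< I x >].

Lemma in_span_closed : zmod_closed in_span.
Proof.
split=> [|x y]; first exact/asboolP/Span0.
by move=> /asboolP Ix /asboolP Iy; apply/asboolP/spanD/spanN.
Qed.
HB.instance Definition _ := GRing.isZmodClosed.Build A in_span in_span_closed.
Definition span_zmod : zmodClosed A := GRing.ZmodClosed.clone A in_span _.
End TwoSidedSpan.

Section AlgebraQuotient.
Variables (K : comNzRingType) (A : algType K) (S : A -> Prop).
Hypothesis S_proper : ~ two_sided_span S 1.

(* The argument S_proper only serves to make the quotient a nonzero ring. *)
Definition alg_quot of ~ two_sided_span S 1 : Type :=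
  Quotient.quot (span_zmod S).
Local Notation Q := (alg_quot S_proper).
HB.instance Definition _ := GRing.Zmodule.on Q.

Definition to_quot (x : A) : Q := \pi_(Quotient.quot (span_zmod S)) x.
Definition of_quot (x : Q) : A := repr (x : Quotient.quot (span_zmod S)).

Lemma of_quotK : cancel of_quot to_quot. Proof. exact: reprK. Qed.

Lemma to_quotP x y : (to_quot x = to_quot y) <-> two_sided_span S (x - y).
Proof.
split=> [/eqP|xy].
  by rewrite /to_quot -Quotient.idealrBE => /asboolP.
by apply/eqP; rewrite /to_quot -Quotient.idealrBE; apply/asboolP.
Qed.

Lemma of_to_quot x : two_sided_span S (of_quot (to_quot x) - x).
Proof. by apply/to_quotP; rewrite of_quotK. Qed.

Lemma to_quot_zmod : zmod_morphism to_quot.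
Proof. by move=> x y; rewrite /to_quot piE. Qed.
HB.instance Definition _ := GRing.isZmodMorphism.Build A Q to_quot to_quot_zmod.

Definition quot_mul (x y : Q) : Q := to_quot (of_quot x * of_quot y).
Definition quot_scale (c : K) (x : Q) : Q := to_quot (c *: of_quot x).

Lemma to_quotM x y : to_quot (x * y) = quot_mul (to_quot x) (to_quot y).
Proof.
apply/to_quotP; set x' := of_quot _; set y' := of_quot _.
have -> : x * y - x' * y' = - ((x' - x) * y' + x * (y' - y)).
  by rewrite mulrBl mulrBr addrA subrK opprB.
by apply/spanN/spanD; [apply: spanMr | apply: spanMl]; apply: of_to_quot.
Qed.

Lemma to_quotZ c x : to_quot (c *: x) = quot_scale c (to_quot x).
Proof.
apply/to_quotP; rewrite -scalerBr -mulr_algl -opprB mulrN.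
by apply/spanN/spanMl/of_to_quot.
Qed.

Lemma quot_mulA : associative quot_mul.
Proof.
move=> x y z; rewrite -[x]of_quotK -[y]of_quotK -[z]of_quotK.
by rewrite -!to_quotM mulrA.
Qed.
Lemma quot_mul1r : left_id (to_quot 1) quot_mul.
Proof. by move=> x; rewrite -[x]of_quotK -to_quotM mul1r. Qed.
Lemma quot_mulr1 : right_id (to_quot 1) quot_mul.
Proof. by move=> x; rewrite -[x]of_quotK -to_quotM mulr1. Qed.
Lemma quot_mulDl : left_distributive quot_mul +%R.
Proof.
move=> x y z; rewrite -[x]of_quotK -[y]of_quotK -[z]of_quotK.
by rewrite -raddfD -!to_quotM mulrDl raddfD.
Qed.
Lemma quot_mulDr : right_distributive quot_mul +%R.
Proof.
move=> x y z; rewrite -[x]of_quotK -[y]of_quotK -[z]of_quotK.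
by rewrite -raddfD -!to_quotM mulrDr raddfD.
Qed.
Lemma quot_oner_neq0 : to_quot 1 != 0.
Proof.
by apply/eqP; rewrite -(raddf0 to_quot) => /to_quotP; rewrite subr0.
Qed.
HB.instance Definition _ := GRing.Zmodule_isNzRing.Build Q
  quot_mulA quot_mul1r quot_mulr1 quot_mulDl quot_mulDr quot_oner_neq0.

Lemma quot_scalerA a b x : quot_scale a (quot_scale b x) = quot_scale (a * b) x.
Proof. by rewrite -[x]of_quotK -!to_quotZ scalerA. Qed.
Lemma quot_scale1r : left_id 1 quot_scale.
Proof. by move=> x; rewrite -[x]of_quotK -!to_quotZ scale1r. Qed.
Lemma quot_scalerDr : right_distributive quot_scale +%R.
Proof.
move=> c x y; rewrite -[x]of_quotK -[y]of_quotK.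
by rewrite -raddfD -!to_quotZ scalerDr raddfD.
Qed.
Lemma quot_scalerDl x : {morph quot_scale^~ x : a b / a + b}.
Proof. by move=> a b; rewrite -[x]of_quotK -!to_quotZ scalerDl raddfD. Qed.
HB.instance Definition _ := GRing.Zmodule_isLmodule.Build K Q
  quot_scalerA quot_scale1r quot_scalerDr quot_scalerDl.

Lemma quot_scalerAl (c : K) (x y : Q) : c *: (x * y) = (c *: x) * y.
Proof.
rewrite /GRing.mul /GRing.scale /= -[x]of_quotK -[y]of_quotK.
by rewrite -!(to_quotZ, to_quotM) scalerAl.
Qed.
HB.instance Definition _ := GRing.Lmodule_isLalgebra.Build K Q quot_scalerAl.
Lemma quot_scalerAr (c : K) (x y : Q) : c *: (x * y) = x * (c *: y).
Proof.
rewrite /GRing.mul /GRing.scale /= -[x]of_quotK -[y]of_quotK.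
by rewrite -!(to_quotZ, to_quotM) scalerAr.
Qed.
HB.instance Definition _ := GRing.Lalgebra_isAlgebra.Build K Q quot_scalerAr.

Lemma to_quot_monoid : monoid_morphism to_quot.
Proof. by split=> // x y; apply: to_quotM. Qed.
HB.instance Definition _ :=
  GRing.isMonoidMorphism.Build A Q to_quot to_quot_monoid.
HB.instance Definition _ := GRing.isScalable.Build K A Q *:%R to_quot to_quotZ.

Lemma to_quot_eq0 s : S s -> to_quot s = 0.
Proof.
by move=> Ss; rewrite -(raddf0 to_quot); apply/to_quotP; rewrite subr0; apply: span_gen.
Qed.

Lemma quot_lift (B : algType K) (f : {lrmorphism A -> B}) :
  (forall s, S s -> f s = 0) ->
  exists g : {lrmorphism Q -> B}, forall x, g (to_quot x) = f x.
Proof.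
move=> fS; pose g (x : Q) := f (of_quot x).
have gE x : g (to_quot x) = f x.
  by apply/eqP; rewrite -subr_eq0 -rmorphB (span_ker fS) //; apply: of_to_quot.
have gB : zmod_morphism g.
  by move=> x y; rewrite -[x]of_quotK -[y]of_quotK -raddfB !gE raddfB.
have gM : monoid_morphism g.
  split=> [|x y]; first by rewrite -[1](rmorph1 to_quot) gE rmorph1.
  by rewrite -[x]of_quotK -[y]of_quotK -rmorphM !gE rmorphM.
have gZ : scalable g.
  by move=> c x; rewrite -[x]of_quotK -linearZ !gE linearZ.
pose ga := GRing.isZmodMorphism.Build Q B g gB.
pose gm := GRing.isMonoidMorphism.Build Q B g gM.
pose gs := GRing.isScalable.Build K Q B *:%R g gZ.
pose G : {lrmorphism Q -> B} := HB.pack g ga gm gs.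
by exists G.
Qed.

End AlgebraQuotient.

Section Hecke.
Variables (K : fieldType) (r n : nat).
Hypothesis r_gt0 : (0 < r)%N.
Variables (u : 'I_r -> K) (q : K).

(* The generator called T_i in the literature (1 <= i <= n) has index i - 1
   in 'I_n; in particular T_1 is the generator of index 0. *)
Definition hecke_relations (B : algType K) (g : 'I_n -> B) : Prop :=
  [/\ forall i j : 'I_n, (i.+1 < j)%N -> g i * g j = g j * g i,
      forall i j : 'I_n, (0 < i)%N -> j = i.+1 :> nat ->
        g i * g j * g i = g j * g i * g j,
      forall i j : 'I_n, i = 0%N :> nat -> j = 1%N :> nat ->
        g i * g j * g i * g j = g j * g i * g j * g i,
      forall i : 'I_n, i = 0%N :> nat -> \prod_(k < r) (g i - (u k)%:A) = 0 &
      forall i : 'I_n, (0 < i)%N -> (g i - 1) * (g i + q%:A) = 0].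

Inductive hecke_relator (F : algType K) (T : 'I_n -> F) : F -> Prop :=
| HeckeComm (i j : 'I_n) : (i.+1 < j)%N ->
    hecke_relator T (T i * T j - T j * T i)
| HeckeBraid3 (i j : 'I_n) : (0 < i)%N -> j = i.+1 :> nat ->
    hecke_relator T (T i * T j * T i - T j * T i * T j)
| HeckeBraid4 (i j : 'I_n) : i = 0%N :> nat -> j = 1%N :> nat ->
    hecke_relator T (T i * T j * T i * T j - T j * T i * T j * T i)
| HeckeCyclotomic (i : 'I_n) : i = 0%N :> nat ->
    hecke_relator T (\prod_(k < r) (T i - (u k)%:A))
| HeckeQuadratic (i : 'I_n) : (0 < i)%N ->
    hecke_relator T ((T i - 1) * (T i + q%:A)).

Lemma hecke_relatorP (F B : algType K) (f : {lrmorphism F -> B})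
    (T : 'I_n -> F) (g : 'I_n -> B) : (forall i, f (T i) = g i) ->
  hecke_relations g <-> (forall s, hecke_relator T s -> f s = 0).
Proof.
move=> fT.
have E1 i j : f (T i * T j - T j * T i) = g i * g j - g j * g i.
  by rewrite rmorphB !rmorphM /= !fT.
have E2 i j : f (T i * T j * T i - T j * T i * T j)
            = g i * g j * g i - g j * g i * g j.
  by rewrite rmorphB !rmorphM /= !fT.
have E3 i j : f (T i * T j * T i * T j - T j * T i * T j * T i)
            = g i * g j * g i * g j - g j * g i * g j * g i.
  by rewrite rmorphB !rmorphM /= !fT.
have E4 i : f (\prod_(k < r) (T i - (u k)%:A))
          = \prod_(k < r) (g i - (u k)%:A).
  rewrite rmorph_prod; apply: eq_bigr => k _.
  by rewrite rmorphB /= linearZ /= rmorph1 fT.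
have E5 i : f ((T i - 1) * (T i + q%:A)) = (g i - 1) * (g i + q%:A).
  by rewrite rmorphM rmorphB rmorphD /= linearZ /= rmorph1 fT.
split=> [[R1 R2 R3 R4 R5] _ [i j ij|i j i0 ij|i j i0 j1|i i0|i i0]|fR].
- by rewrite E1 R1 ?subrr.
- by rewrite E2 R2 ?subrr.
- by rewrite E3 R3 ?subrr.
- by rewrite E4 R4.
- by rewrite E5 R5.
split=> [i j ij|i j i0 ij|i j i0 j1|i i0|i i0].
- by apply/eqP; rewrite -subr_eq0 -E1 fR //; apply: HeckeComm.
- by apply/eqP; rewrite -subr_eq0 -E2 fR //; apply: HeckeBraid3.
- by apply/eqP; rewrite -subr_eq0 -E3 fR //; apply: HeckeBraid4.
- by rewrite -E4 fR //; apply: HeckeCyclotomic.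
- by rewrite -E5 fR //; apply: HeckeQuadratic.
Qed.

Lemma hecke_relations_rescale (B : algType K) (T : 'I_n -> B)
    (z : K) (s : 'I_r -> 'I_r) :
    injective s -> (forall k, z * u (s k) = u k) -> hecke_relations T ->
  hecke_relations (fun i => (if i == 0 :> nat then z else 1) *: T i).
Proof.
move=> s_inj su [R1 R2 R3 R4 R5]; set g := fun i : 'I_n => _.
have gE (i : 'I_n) : (0 < i)%N -> g i = T i.
  by rewrite /g; case: eqP => [->|_ _]; rewrite ?scale1r.
have g0 (i : 'I_n) : i = 0%N :> nat -> g i = z *: T i.
  by rewrite /g => ->.
split=> [i j ij|i j i0 ij|i j i0 j1|i i0|i i0].
- rewrite /g -!scalerAl -!scalerAr !scalerA R1 //; congr (_ *: _); exact: mulrC.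
- by rewrite !gE ?ij // R2.
- rewrite (gE j) ?j1 // g0 //.
  by rewrite !(=^~ scalerAl, =^~ scalerAr, scalerA) R3.
- rewrite g0 //.
  pose P (c : 'I_r -> K) := \prod_(k < r) ('X - (c k)%:P).
  have PE c (y : B) : horner_alg y (P c) = \prod_(k < r) (y - (c k)%:A).
    rewrite rmorph_prod; apply: eq_bigr => k _.
    by rewrite rmorphB /= horner_algX horner_algC.
  rewrite (eq_bigr (fun k => z *: (T i - (u (s k))%:A))); last first.
    by move=> k _; rewrite scalerBr scalerA su.
  rewrite scaler_prod -(PE (u \o s)).
  have -> : P (u \o s) = P u by rewrite [RHS](reindex_inj s_inj).
  by rewrite PE R4 // scaler0.
- by rewrite gE // R5.
Qed.

Local Notation free_relator := (hecke_relator (@free_gen K 'I_n)).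

(* T_1 |-> u_1, T_i |-> 1 (i > 1) is a one-dimensional representation. *)
Lemma hecke_proper : ~ two_sided_span free_relator 1.
Proof.
pose g (i : 'I_n) : K^o := if (i == 0 :> nat)%N then u (Ordinal r_gt0) else 1.
move=> /(@span_ker _ _ _ (free_lift g)) f1.
suff /(hecke_relatorP (free_lift_gen g))/f1/eqP : hecke_relations g.
  by rewrite rmorph1 oner_eq0.
have gS (i : 'I_n) : (0 < i)%N -> g i = 1 by rewrite /g; case: eqP => // ->.
have cK (x y : K^o) : x * y = y * x by apply: (@mulrC K).
split=> [i j _|i j i0 ij|i j i0 j1|i i0|i i0].
- exact: cK.
- by rewrite !gS ?ij.
- by rewrite cK !mulrA.
- rewrite (bigD1 (Ordinal r_gt0)) //= {1}/g i0 /=.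
  have -> : (u (Ordinal r_gt0))%:A = u (Ordinal r_gt0) :> K^o.
    exact: (@mulr1 K).
  by rewrite subrr mul0r.
- by rewrite gS // subrr mul0r.
Qed.

Definition hecke : algType K := alg_quot hecke_proper.
Definition hecke_gen (i : 'I_n) : hecke := to_quot hecke_proper (free_gen K i).

Lemma hecke_genP : hecke_relations hecke_gen.
Proof.
apply/(hecke_relatorP (f := to_quot hecke_proper) (fun=> erefl)).
exact: to_quot_eq0.
Qed.

Lemma hecke_lift (B : algType K) (g : 'I_n -> B) : hecke_relations g ->
  exists f : {lrmorphism hecke -> B}, forall i, f (hecke_gen i) = g i.
Proof.
move=> /(hecke_relatorP (free_lift_gen g))/(quot_lift hecke_proper)[f fE].
by exists f => i; rewrite fE [LHS]free_lift_gen.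
Qed.

Lemma hecke_hom_ext (B : algType K) (f g : {lrmorphism hecke -> B}) :
  (forall i, f (hecke_gen i) = g (hecke_gen i)) -> f =1 g.
Proof.
move=> fg x; rewrite -[x](@of_quotK _ _ _ hecke_proper).
pose pr : {lrmorphism free_alg K 'I_n -> hecke} := to_quot hecke_proper.
transitivity (free_lift (fun i => f (hecke_gen i)) (of_quot x)).
  exact: (@free_lift_uniq _ _ _ _ (f \o pr : {lrmorphism _ -> _})).
symmetry; exact: (@free_lift_uniq _ _ _ _ (g \o pr : {lrmorphism _ -> _})).
Qed.

(* L_y = q^(1-y) T_y ... T_2 T_1 T_2 ... T_y, where y has index y - 1 *)
Definition jucys_murphy (y : 'I_n) : hecke :=
  q ^- y *: ((\prod_(i <- rev (enum 'I_n) | (i <= y)%N) hecke_gen i)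
             * \prod_(i < n | (0 < i <= y)%N) hecke_gen i).

End Hecke.

(* For the parameters u_j = xi^k v_l with j - 1 = l p + k, the algebra has the
   automorphism T_1 |-> xi T_1, T_i |-> T_i (i > 1). *)
Lemma hecke_tau_exists (K : fieldType) (r n p d : nat) (r_gt0 : (0 < r)%N)
    (xi q : K) (v : 'I_d -> K) (u : 'I_r -> K) :
    (p %| r)%N -> d = (r %/ p)%N -> p.-primitive_root xi ->
    (forall (j : 'I_r) (l : 'I_d) (k : 'I_p),
       j = (l * p + k)%N :> nat -> u j = xi ^+ k * v l) ->
  exists tau tau' : {lrmorphism hecke n r_gt0 u q -> hecke n r_gt0 u q},
    [/\ cancel tau tau', cancel tau' tau,
        forall i : 'I_n, i = 0%N :> nat ->
          tau (hecke_gen r_gt0 u q i) = xi *: hecke_gen r_gt0 u q i &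
        forall i : 'I_n, (0 < i)%N ->
          tau (hecke_gen r_gt0 u q i) = hecke_gen r_gt0 u q i].
Proof.
move=> p_r dE xi_prim uE; have p_gt0 := prim_order_gt0 xi_prim.
have xi_neq0 : xi != 0.
  apply: contra_eq_neq (prim_expr_order xi_prim) => ->.
  by rewrite expr0n gtn_eqF // eq_sym oner_eq0.
have r_dp : r = (d * p)%N by rewrite dE divnK.
have s_lt (j : 'I_r) : (j %/ p * p + (j %% p + p.-1) %% p < r)%N.
  have : (j %/ p < d)%N by rewrite ltn_divLR // -r_dp.
  rewrite -(leq_pmul2r p_gt0) -r_dp; apply: leq_trans.
  by rewrite mulSn addnC ltn_add2r ltn_pmod.
pose s j := Ordinal (s_lt j).
have su k : xi * u (s k) = u k.
  have l_lt : (k %/ p < d)%N by rewrite ltn_divLR // -r_dp.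
  have m_lt : (k %% p < p)%N by rewrite ltn_pmod.
  have m'_lt : ((k %% p + p.-1) %% p < p)%N by rewrite ltn_pmod.
  rewrite (uE k (Ordinal l_lt) (Ordinal m_lt)) /= -?divn_eq //.
  rewrite (uE (s k) (Ordinal l_lt) (Ordinal m'_lt)) //=.
  rewrite mulrA -exprS -(prim_expr_mod xi_prim) -addn1 modnDml -addnA addn1.
  by rewrite prednK // modnDr modn_mod.
have s_inj : injective s.
  move=> j k /(congr1 val) /= jk; apply/val_inj => /=.
  have mp x : ((x %% p + p.-1) %% p < p)%N by rewrite ltn_pmod.
  have /(congr1 (fun m => m %/ p)%N) := jk.
  rewrite !divnMDl // !(divn_small (mp _)) !addn0 => jk1.
  have /(congr1 (fun m => m %% p)%N) := jk.
  rewrite !modnMDl !modn_mod => /eqP; rewrite eqn_modDr !modn_mod => /eqP jk2.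
  by rewrite (divn_eq j p) (divn_eq k p) jk1 jk2.
have [t sK tK] := injF_bij s_inj.
have tu k : xi^-1 * u (t k) = u k by rewrite -[u (t k)]su tK mulKf.
have [f fE] := hecke_lift r_gt0 (hecke_relations_rescale s_inj su
                              (hecke_genP n r_gt0 u q)).
have [g gE] := hecke_lift r_gt0 (hecke_relations_rescale (can_inj tK) tu
                              (hecke_genP n r_gt0 u q)).
exists f, g; split.
- apply: (@hecke_hom_ext _ _ _ _ _ _ _ (g \o f : {lrmorphism _ -> _}) idfun) => i.
  rewrite /= fE linearZ /= gE scalerA.
  by case: eqP; rewrite ?divff // ?mul1r scale1r.
- apply: (@hecke_hom_ext _ _ _ _ _ _ _ (f \o g : {lrmorphism _ -> _}) idfun) => i.
  rewrite /= gE linearZ /= fE scalerA.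
  by case: eqP; rewrite ?mulVf // ?mul1r scale1r.
- by move=> i i0; rewrite fE i0.
- by move=> i i0; rewrite fE gtn_eqF // scale1r.
Qed.

Section Modules.
Variable A : pzRingType.

Definition is_submodule (M : lmodType A) (N : M -> Prop) : Prop :=
  N 0 /\ forall (a : A) x y, N x -> N y -> N (a *: x + y).

Definition simple_module (M : lmodType A) : Prop :=
  (exists x : M, x <> 0) /\
  forall N : M -> Prop, is_submodule N ->
    (forall x, N x -> x = 0) \/ (forall x, N x).

Definition semisimple_module (M : lmodType A) : Prop :=
  forall N : M -> Prop, is_submodule N ->
  exists N' : M -> Prop, [/\ is_submodule N',
    forall x, N x -> N' x -> x = 0 &
    forall x, exists y z, [/\ N y, N' z & x = y + z]].

Definition module_iso (M N : lmodType A) : Prop :=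
  exists f : {linear M -> N}, bijective f.

(* restriction of scalars: h acts on twist f M as f h acts on M *)
Definition twist (f : {rmorphism A -> A}) (M : lmodType A) : Type := M.

Section Twist.
Variables (f : {rmorphism A -> A}) (M : lmodType A).
Local Notation fM := (twist f M).
HB.instance Definition _ := GRing.Zmodule.on fM.

Definition twist_scale (h : A) (m : fM) : fM := f h *: (m : M).

Lemma twist_scalerA a b m :
  twist_scale a (twist_scale b m) = twist_scale (a * b) m.
Proof. by rewrite /twist_scale scalerA rmorphM. Qed.
Lemma twist_scale1r : left_id 1 twist_scale.
Proof. by move=> m; rewrite /twist_scale rmorph1 scale1r. Qed.
Lemma twist_scalerDr : right_distributive twist_scale +%R.
Proof. by move=> a x y; rewrite /twist_scale [LHS]scalerDr. Qed.
Lemma twist_scalerDl m : {morph twist_scale^~ m : a b / a + b}.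
Proof. by move=> a b; rewrite /twist_scale rmorphD [LHS]scalerDl. Qed.
HB.instance Definition _ := GRing.Zmodule_isLmodule.Build A fM
  twist_scalerA twist_scale1r twist_scalerDr twist_scalerDl.
End Twist.

End Modules.

Definition semisimple_ring (A : nzRingType) : Prop := semisimple_module A^o.

Definition is_basis (K : fieldType) (A : algType K) (M : lmodType A)
    (I : finType) (v : I -> M) : Prop :=
  forall m : M, exists! c : {ffun I -> K}, m = \sum_i (c i)%:A *: v i.

Record young_diagram := YoungDiagram {
  rows :> seq nat;
  rowsP : sorted geq rows && (0%N \notin rows)
}.

Section Tableaux.
Variables (p d n : nat).

Definition multidiagram := 'I_p -> 'I_d -> young_diagram.

Definition total_size (lam : multidiagram) : nat :=
  (\sum_i \sum_j sumn (lam i j))%N.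

Definition shift (lam : multidiagram) : multidiagram :=
  fun i j => lam (ordS i) j.

(* ((i, j), (k, l)): row k and column l, counted from 0, of component (i, j);
   the bounds k, l < n are no restriction for diagrams of total size n. *)
Definition cell := (('I_p * 'I_d) * ('I_n * 'I_n))%type.

Definition in_diagram (lam : multidiagram) (c : cell) : bool :=
  (c.2.2 < nth 0 (lam c.1.1 c.1.2) c.2.1)%N.

(* t x is the cell containing the entry x + 1 *)
Definition is_standard (lam : multidiagram) (t : {ffun 'I_n -> cell}) : bool :=
  [&& injectiveb t,
      [forall c, (c \in codom t) == in_diagram lam c],
      [forall x, forall y,
         [&& (t x).1 == (t y).1, (t x).2.1 == (t y).2.1
           & ((t x).2.2 < (t y).2.2)%N] ==> (x < y)%N] &
      [forall x, forall y,
         [&& (t x).1 == (t y).1, (t x).2.2 == (t y).2.2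
           & ((t x).2.1 < (t y).2.1)%N] ==> (x < y)%N]].

Definition std_tableau (lam : multidiagram) := {t | is_standard lam t}.

(* (a(t, y), b(t, y)) *)
Definition component (t : {ffun 'I_n -> cell}) (y : 'I_n) : 'I_p * 'I_d :=
  (t y).1.

Definition content (t : {ffun 'I_n -> cell}) (y : 'I_n) : int :=
  ((t y).2.2 : nat)%:Z - ((t y).2.1 : nat)%:Z.

Definition swap_entries (x y : 'I_n) (t : {ffun 'I_n -> cell}) :=
  [ffun z => t (if z == x then y else if z == y then x else z)].

End Tableaux.

Section ArikiKoike.
Variables (K : fieldType) (r n p d : nat) (r_gt0 : (0 < r)%N).
Variables (u : 'I_r -> K) (q : K) (w : 'I_p * 'I_d -> K).

Definition qint (k : int) : K :=
  if q == 1 then k%:~R else (1 - q ^ k) / (1 - q).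

(* eigenvalue of L_y on v(t) *)
Definition jm_eigenvalue (t : {ffun 'I_n -> cell p d n}) (y : 'I_n) : K :=
  w (component t y) * q ^ (- content t y).

(* Diagonal coefficient at v(t) of the generator exchanging the consecutive
   entries x and y = x + 1.  If these lie in different components, it is
   (1 - q) b / (b - a), where a and b are the eigenvalues of L_x and L_y on
   v(t); if they lie in the same one, the common factor w cancels out and
   1 / [c(t, y) - c(t, x)]_q is what remains, also for q = 1 or w = 0. *)
Definition diag_coef (t : {ffun 'I_n -> cell p d n}) (x y : 'I_n) : K :=
  if component t x == component t y then (qint (content t y - content t x))^-1
  else (1 - q) * jm_eigenvalue t y / (jm_eigenvalue t y - jm_eigenvalue t x).

(* Ariki and Koike's seminormal form, rescaled so that the eigenvalues of
   T_2, ..., T_n are 1 and -q.  The last condition describes the action of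
   T_i (i > 1) on v(t): v(t) is multiplied by 1 (resp. -q) if i - 1 and i are
   in the same row (resp. column) of t, and otherwise T_i preserves the span
   of v(t) and v(s t), where s t is t with i - 1 and i exchanged.  The action
   of the L_y alone would not determine the module if q = 1 or if some w is 0:
   for r = 1, n = 2 and q = 1 the diagrams (2) and (1,1) yield the same
   eigenvalues. *)
Definition ak_basis (lam : multidiagram p d) (M : lmodType (hecke n r_gt0 u q))
    (v : std_tableau n lam -> M) : Prop :=
  [/\ is_basis v,
      forall (i : 'I_n) (t : std_tableau n lam), i = 0%N :> nat ->
        hecke_gen r_gt0 u q i *: v t = (w (component (val t) i))%:A *: v t,
      forall (y : 'I_n) (t : std_tableau n lam),
        jucys_murphy r_gt0 u q y *: v t = (jm_eigenvalue (val t) y)%:A *: v t &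
      forall (x i : 'I_n) (t : std_tableau n lam), i = x.+1 :> nat ->
        let alpha := diag_coef (val t) x i in
        hecke_gen r_gt0 u q i *: v t =
          alpha%:A *: v t
          + (q + alpha)%:A *: oapp v 0 (insub (swap_entries x i (val t)))].

Definition is_ariki_koike (lam : multidiagram p d)
    (M : lmodType (hecke n r_gt0 u q)) : Prop :=
  simple_module M /\ exists v : std_tableau n lam -> M, ak_basis v.

End ArikiKoike.

(* Main.v *)
(* With w_(i,j) = xi^(-i-1) v_j (all exponents are modulo p), moving the
   component (i, j) to (i - 1, j) multiplies every eigenvalue of L_1, ..., L_n
   by xi, while the seminormal coefficients of T_2, ..., T_n are homogeneous of
   degree 0 in these eigenvalues and do not change.  The scalar xi is undone by
   tau^-1(T_1) = xi^-1 T_1, so the relabelling of standard tableaux carries the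
   basis of V(lambda) to a basis of the twist of V(shift lambda) on which the
   generators have the same matrices. *)
From HB Require Import structures.
Require Import Defs.
From mathcomp Require Import all_boot all_order all_algebra.
From mathcomp Require Import reals complex.
From mathcomp Require Import boolp monalg.
Set Implicit Arguments.
Unset Strict Implicit.
Unset Printing Implicit Defensive.
Import GRing.Theory.
Local Open Scope ring_scope.

(** * Linear maps and bases over the ground field *)

Section ScalarLinearMaps.
Variables (K : fieldType) (A : algType K).

(** Modules carry only an action of [A], so linearity over [K] is expressed through the scalars
    [c%:A]. *)
Definition scalar_linear (M N : lmodType A) (f : M -> N) : Prop :=
  forall (c : K) x y, f (c%:A *: x + y) = c%:A *: f x + f y.

Section Theory.
Variables (M N : lmodType A) (f : M -> N).
Hypothesis f_lin : scalar_linear f.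

Lemma scalar_linearD x y : f (x + y) = f x + f y.
Proof. by have := f_lin 1 x y; rewrite !scale1r. Qed.

Lemma scalar_linear0 : f 0 = 0.
Proof. by apply: (addrI (f 0)); rewrite -scalar_linearD !addr0. Qed.

Lemma scalar_linearZ (c : K) x : f (c%:A *: x) = c%:A *: f x.
Proof. by have := f_lin c x 0; rewrite !addr0 scalar_linear0 addr0. Qed.

Lemma scalar_linear_sum (I : finType) (F : I -> M) :
  f (\sum_i F i) = \sum_i f (F i).
Proof. exact: (big_morph f scalar_linearD scalar_linear0). Qed.

End Theory.

Lemma scalar_linear_scale (M : lmodType A) (h : A) :
  scalar_linear (fun x : M => h *: x).
Proof.
move=> c x y; rewrite scalerDr !scalerA.
by rewrite mulr_algr mulr_algl.
Qed.

Lemma scalar_linear_comp (M N P : lmodType A) (g : N -> P) (f : M -> N) :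
  scalar_linear g -> scalar_linear f -> scalar_linear (g \o f).
Proof. by move=> g_lin f_lin c x y /=; rewrite f_lin g_lin. Qed.

Lemma scalar_linear_ext (M N : lmodType A) (I : finType) (v : I -> M)
    (f g : M -> N) : is_basis v -> scalar_linear f -> scalar_linear g ->
  (forall i, f (v i) = g (v i)) -> f =1 g.
Proof.
move=> v_basis f_lin g_lin fg x; have [c [-> _]] := v_basis x.
rewrite (scalar_linear_sum f_lin) (scalar_linear_sum g_lin).
apply: eq_bigr => i _.
by rewrite (scalar_linearZ f_lin) (scalar_linearZ g_lin) fg.
Qed.

Lemma algMD (a b c : K) : (a * b + c)%:A = a%:A * b%:A + c%:A :> A.
Proof. by rewrite mulr_algl scalerA scalerDl. Qed.

(** Coordinates in the basis [v] are fixed by choice. Their uniqueness makes them additive and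
    homogeneous, so the map with these coordinates on [v'] is linear. *)
Lemma scalar_linear_exists (M N : lmodType A) (I : finType) (v : I -> M)
    (v' : I -> N) : is_basis v ->
  exists2 f : M -> N, scalar_linear f & forall i, f (v i) = v' i.
Proof.
move=> v_basis; have [c cP] := choice v_basis.
have cE x (e : {ffun I -> K}) : x = \sum_i (e i)%:A *: v i -> c x = e.
  by move=> xE; case: (cP x) => _; apply.
exists (fun x => \sum_i (c x i)%:A *: v' i) => [a x y|i].
  rewrite (cE _ [ffun i => a * c x i + c y i]).
    rewrite scaler_sumr -big_split; apply: eq_bigr => i _ /=.
    by rewrite ffunE algMD scalerDl scalerA.
  rewrite {1}(proj1 (cP x)) {1}(proj1 (cP y)) scaler_sumr -big_split.
  apply: eq_bigr => i _ /=.
  by rewrite ffunE algMD scalerDl scalerA.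
(* Stated for any module: in [M] it identifies the coordinates of [v i], in [N] it evaluates the
   resulting sum. *)
have deltaE (P : lmodType A) (z : I -> P) :
    \sum_j ([ffun j => (j == i)%:R : K] j)%:A *: z j = z i.
  rewrite (bigD1 i) //= ffunE eqxx !scale1r big1 ?addr0 // => j /negPf ji.
  by rewrite ffunE ji !scale0r.
by rewrite (cE _ [ffun j => (j == i)%:R]) deltaE.
Qed.

Lemma is_basis_reindex (M : lmodType A) (I J : finType) (v : I -> M)
    (s : J -> I) : is_basis v -> bijective s -> is_basis (v \o s).
Proof.
move=> v_basis [s' sK s'K] x; have [c [cE c_uniq]] := v_basis x.
exists [ffun j => c (s j)]; split=> [|e eE].
  rewrite {1}cE (reindex s) /=; last by exists s' => ? _.
  by apply: eq_bigr => j _; rewrite ffunE.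
apply/ffunP => j; rewrite ffunE (c_uniq [ffun i => e (s' i)]) ?ffunE ?sK //.
rewrite {1}eE (reindex s') /=; last by exists s => ? _.
by apply: eq_bigr => i _; rewrite ffunE s'K.
Qed.

(** An algebra endomorphism fixes the scalars [c%:A], so twisting leaves the vector space structure,
    and hence bases, unchanged. *)
Lemma twist_algE (f : {lrmorphism A -> A}) (M : lmodType A) (c : K) (x : M) :
  c%:A *: (x : twist f M) = c%:A *: x.
Proof. by rewrite -[in RHS](rmorph_alg f). Qed.

Lemma is_basis_twist (f : {lrmorphism A -> A}) (M : lmodType A) (I : finType)
    (v : I -> M) : is_basis v -> is_basis (v : I -> twist f M).
Proof.
move=> v_basis x; have [c [cE c_uniq]] := v_basis x.
have sumE (e : {ffun I -> K}) :
    \sum_i (e i)%:A *: (v i : twist f M) = \sum_i (e i)%:A *: v i.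
  by apply: eq_bigr => i _; rewrite twist_algE.
exists c; split=> [|e eE]; first by rewrite sumE.
by apply: c_uniq; rewrite -sumE.
Qed.

End ScalarLinearMaps.

(** * Isomorphisms of modules over the Hecke algebra *)

Section HeckeModules.
Variables (K : fieldType) (n r : nat) (r_gt0 : (0 < r)%N).
Variables (u : 'I_r -> K) (q : K).
Local Notation H := (hecke n r_gt0 u q).
Local Notation T := (@hecke_gen K r n r_gt0 u q).

(** Every element is the image of a linear combination of words in the generators: the induction
    runs over the terms of the combination, then over the letters of each word. *)
Lemma hecke_ind (P : H -> Prop) :
  P 1 -> (forall (c : K) x y, P x -> P y -> P (c *: x + y)) ->
  (forall i x, P x -> P (T i * x)) -> forall x, P x.
Proof.
move=> P1 PZD PM x.
have P0 : P 0 by rewrite -[0](addNr 1) -scaleN1r; apply: PZD.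
pose proper := @hecke_proper K r n r_gt0 u q.
pose pr : {lrmorphism free_alg K 'I_n -> H} := to_quot proper.
rewrite -[x](@of_quotK _ _ _ proper); set y := of_quot _.
rewrite -[to_quot _ y]/(pr y) [y]monalgE raddf_sum.
elim/big_rec: _ => // m z _ Pz.
have -> : << y@_m *g m >> = y@_m *: (<< m >> : free_alg K 'I_n).
  by rewrite -[RHS]mul_malgC /GRing.mul /= fgmulUU mulr1 mul1m.
rewrite [X in X + _]linearZ; apply: PZD Pz; rewrite -[X in P X]/(pr _).
case: m => s; elim: s => [|i s IHs].
  have -> : FMonom [::] = mone :> {fmonom 'I_n}.
    by apply: val_inj; rewrite /= fm1.
  by rewrite [pr _]rmorph1.
have -> : FMonom (i :: s) = mmul (fmu i) (FMonom s) :> {fmonom 'I_n}.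
  by apply: val_inj; rewrite /= fmM fmU.
have -> : << mmul (fmu i) (FMonom s) >>
        = free_gen K i * << FMonom s >> :> free_alg K 'I_n.
  by rewrite /GRing.mul /= fgmulUU mulr1.
by rewrite [pr _]rmorphM; apply: PM.
Qed.

(* The last hypothesis says that the generators have the same matrices on the
   two bases. *)
Lemma hecke_module_iso (M N : lmodType H) (I : finType) (v : I -> M)
    (v' : I -> N) : is_basis v -> is_basis v' ->
    (forall f : M -> N, scalar_linear f -> (forall t, f (v t) = v' t) ->
       forall i t, f (T i *: v t) = T i *: v' t) ->
  module_iso M N.
Proof.
move=> vB v'B fT.
have [f f_lin fv] := scalar_linear_exists v' vB.
have [g g_lin gv] := scalar_linear_exists v v'B.
have id_lin (P : lmodType H) : scalar_linear (@id P) by move=> c x y.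
have gf : cancel f g.
  apply: (scalar_linear_ext vB (scalar_linear_comp g_lin f_lin) (id_lin M)).
  by move=> t /=; rewrite fv gv.
have fg : cancel g f.
  apply: (scalar_linear_ext v'B (scalar_linear_comp f_lin g_lin) (id_lin N)).
  by move=> t /=; rewrite gv fv.
have f_gen i x : f (T i *: x) = T i *: f x.
  move: x; apply: (scalar_linear_ext vB).
  - exact: (scalar_linear_comp f_lin (scalar_linear_scale (T i))).
  - exact: (scalar_linear_comp (scalar_linear_scale (T i)) f_lin).
  - by move=> t; rewrite fv fT.
(* Commutation with the generators extends to the whole algebra by [hecke_ind]. *)
have fZ h x : f (h *: x) = h *: f x.
  elim/hecke_ind: h => [|c h k IHh IHk|i h IHh]; first by rewrite !scale1r.
    rewrite -[c *: h]mulr_algl !scalerDl -!scalerA f_lin.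
    by rewrite IHh IHk.
  by rewrite -!scalerA f_gen IHh.
have f_linear : linear f.
  by move=> h x y; rewrite (scalar_linearD f_lin) fZ.
pose fl := GRing.isLinear.Build H M N *:%R f f_linear.
pose F : {linear M -> N} := HB.pack f fl.
by exists F; exists g.
Qed.

End HeckeModules.

(** * Relabelling of standard tableaux under the shift *)

Section ShiftTableaux.
Variables (p d n : nat).

(** Component [i] of [shift lam] is component [i + 1] of [lam], so a cell moves down one index,
    modulo [p]. *)
Definition shift_cell (c : cell p d n) : cell p d n :=
  ((ord_pred c.1.1, c.1.2), c.2).

Definition unshift_cell (c : cell p d n) : cell p d n :=
  ((ordS c.1.1, c.1.2), c.2).

Lemma shift_cellK : cancel shift_cell unshift_cell.
Proof. by case=> [[i j] c]; rewrite /unshift_cell /= ord_predK. Qed.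

Lemma unshift_cellK : cancel unshift_cell shift_cell.
Proof. by case=> [[i j] c]; rewrite /shift_cell /= ordSK. Qed.

Definition shift_tableau (t : {ffun 'I_n -> cell p d n}) :
  {ffun 'I_n -> cell p d n} := [ffun x => shift_cell (t x)].

Definition unshift_tableau (t : {ffun 'I_n -> cell p d n}) :
  {ffun 'I_n -> cell p d n} := [ffun x => unshift_cell (t x)].

Lemma shift_tableauK : cancel shift_tableau unshift_tableau.
Proof. by move=> t; apply/ffunP => x; rewrite !ffunE shift_cellK. Qed.

Lemma unshift_tableauK : cancel unshift_tableau shift_tableau.
Proof. by move=> t; apply/ffunP => x; rewrite !ffunE unshift_cellK. Qed.

Lemma in_diagram_shift lam c :
  in_diagram (shift lam) (shift_cell c) = in_diagram lam c.
Proof. by rewrite /in_diagram /shift /= ord_predK. Qed.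

Lemma shift_component (t : {ffun 'I_n -> cell p d n}) x y :
  ((shift_tableau t x).1 == (shift_tableau t y).1) = ((t x).1 == (t y).1).
Proof.
rewrite !ffunE; case: (t x) (t y) => [[i j] c] [[i' j'] c'] /=.
by rewrite !xpair_eqE (can_eq (@ord_predK p)).
Qed.

Lemma is_standard_shift lam t :
  is_standard (shift lam) (shift_tableau t) = is_standard lam t.
Proof.
rewrite /is_standard; congr [&& _, _, _ & _].
- apply/injectiveP/injectiveP => t_inj x y.
    by move=> txy; apply: t_inj; rewrite !ffunE txy.
  by rewrite !ffunE => /(can_inj shift_cellK)/t_inj.
- have codomE c : (shift_cell c \in codom (shift_tableau t)) = (c \in codom t).
    apply/codomP/codomP => -[x cE]; exists x.
      by move: cE; rewrite ffunE => /(can_inj shift_cellK).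
    by rewrite ffunE cE.
  apply/forallP/forallP => tP c.
    by rewrite -codomE -in_diagram_shift.
  by rewrite -[c]unshift_cellK codomE in_diagram_shift.
- apply: eq_forallb => x; apply: eq_forallb => y.
  by rewrite shift_component !ffunE.
- apply: eq_forallb => x; apply: eq_forallb => y.
  by rewrite shift_component !ffunE.
Qed.

Lemma swap_entries_shift x y t :
  swap_entries x y (shift_tableau t) = shift_tableau (swap_entries x y t).
Proof. by apply/ffunP => z; rewrite !ffunE. Qed.

Lemma shift_tableau_standard lam (t : std_tableau n lam) :
  is_standard (shift lam) (shift_tableau (val t)).
Proof. by rewrite is_standard_shift (valP t). Qed.

Definition shift_std lam (t : std_tableau n lam) : std_tableau n (shift lam) :=
  Sub _ (shift_tableau_standard t).

Lemma shift_std_bij lam : bijective (@shift_std lam).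
Proof.
have std (t : std_tableau n (shift lam)) :
    is_standard lam (unshift_tableau (val t)).
  by rewrite -is_standard_shift unshift_tableauK (valP t).
exists (fun t => Sub _ (std t)) => t; apply: val_inj => /=.
  exact: shift_tableauK.
exact: unshift_tableauK.
Qed.

(** Shifting preserves and reflects standardness, so the default 0 is taken on both sides at once.
    This handles the exchange of entries when its result is not standard. *)
Lemma oapp_insub_shift (V : zmodType) lam (v : std_tableau n (shift lam) -> V) t :
  oapp v 0 (insub (shift_tableau t)) = oapp (v \o @shift_std lam) 0 (insub t).
Proof.
case: (boolP (is_standard lam t)) => [tS|tNS]; last first.
  by rewrite !insubN ?is_standard_shift.
rewrite (insubT _ tS) insubT ?is_standard_shift //= => tS'.
by congr v; apply: val_inj.
Qed.

(** * Effect of the shift on the seminormal coefficients *)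

Section Coefficients.
Variables (K : fieldType) (q z : K) (w : 'I_p * 'I_d -> K).
Hypothesis z_neq0 : z != 0.
Hypothesis w_shift : forall i j, w (ord_pred i, j) = z * w (i, j).

Lemma component_shift t y :
  w (component (shift_tableau t) y) = z * w (component t y).
Proof. by rewrite /component ffunE /= w_shift -surjective_pairing. Qed.

Lemma jm_eigenvalue_shift t y :
  jm_eigenvalue q w (shift_tableau t) y = z * jm_eigenvalue q w t y.
Proof. by rewrite /jm_eigenvalue component_shift /content ffunE mulrA. Qed.

Lemma diag_coef_shift t x y :
  diag_coef q w (shift_tableau t) x y = diag_coef q w t x y.
Proof.
(* Within one component only contents occur; otherwise [z] cancels between numerator and
   denominator. *)
rewrite /diag_coef /component shift_component; case: ifP => _.
  by rewrite /content !ffunE.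
rewrite !jm_eigenvalue_shift -mulrBr mulrCA -mulrA invfM.
by rewrite mulrACA divff // mul1r mulrA.
Qed.

End Coefficients.
End ShiftTableaux.

(** * The ordering of the parameters and the isomorphism *)

Theorem theorem4p1 (R : realType) (n r p d : nat)
    (n_ge2 : (2 <= n)%N) (r_gt0 : (0 < r)%N)
    (p_dvd_r : (p %| r)%N) (d_def : d = (r %/ p)%N)
    (xi : R[i]) (xi_prim : p.-primitive_root xi)
    (q : R[i]) (q_neq0 : q <> 0)
    (v : 'I_d -> R[i])
    (v_distinct : forall i j : 'I_d, i <> j -> v i ^+ p <> v j ^+ p)
    (u : 'I_r -> R[i])
    (u_def : forall (j : 'I_r) (l : 'I_d) (k : 'I_p),
       j = (l * p + k)%N :> nat -> u j = xi ^+ k * v l)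
    (H_semisimple : semisimple_ring (hecke n r_gt0 u q))
    (tau tau_inv : {lrmorphism hecke n r_gt0 u q -> hecke n r_gt0 u q})
    (tauK : cancel tau tau_inv) (tau_invK : cancel tau_inv tau)
    (tau_T1 : forall i : 'I_n, i = 0%N :> nat ->
       tau (hecke_gen r_gt0 u q i) = xi *: hecke_gen r_gt0 u q i)
    (tau_Ti : forall i : 'I_n, (0 < i)%N ->
       tau (hecke_gen r_gt0 u q i) = hecke_gen r_gt0 u q i) :
  exists ordering : 'I_p * 'I_d -> 'I_r,
    bijective ordering /\
    let w := fun ij => u (ordering ij) in
    forall lam : multidiagram p d, total_size lam = n ->
    forall M N : lmodType (hecke n r_gt0 u q),
      is_ariki_koike w (shift lam) M -> is_ariki_koike w lam N ->
      module_iso (twist tau_inv M) N.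
Proof.
have p_gt0 := prim_order_gt0 xi_prim.
have xi_neq0 : xi != 0.
  apply: contra_eq_neq (prim_expr_order xi_prim) => ->.
  by rewrite expr0n gtn_eqF // eq_sym oner_eq0.
have r_dp : r = (d * p)%N by rewrite d_def divnK.
(* The exponent -i-1 modulo [p] is represented by [rev_ord i], that is p-1-i. *)
have ord_lt (ij : 'I_p * 'I_d) : (ij.2 * p + rev_ord ij.1 < r)%N.
  rewrite r_dp (@leq_trans (ij.2.+1 * p)) ?leq_mul2r ?ltn_ord ?orbT //.
  by rewrite mulSn addnC ltn_add2r.
pose ordering ij := Ordinal (ord_lt ij).
have ordering_inj : injective ordering.
  move=> [i j] [i' j'] /(congr1 val) /= ijE.
  have lt k : (p - k.+1 < p)%N by rewrite ltn_subrL.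
  have jE : j = j'.
    apply: val_inj; have := congr1 (fun m => m %/ p)%N ijE.
    by rewrite !divnMDl // !(divn_small (lt _)) !addn0.
  rewrite jE in ijE *; move/addnI: ijE => iE.
  by congr (_, _); apply/rev_ord_inj/val_inj.
exists ordering; split.
  by apply: inj_card_bij => //; rewrite card_prod !card_ord r_dp mulnC.
move=> w lam _ M N [_ [vM [vM_basis vM_T1 _ vM_T]]] [_ [vN [vN_basis vN_T1 _ vN_T]]].
have wE i j : w (i, j) = xi ^+ rev_ord i * v j by apply: u_def.
have w_shift i j : w (ord_pred i, j) = xi * w (i, j).
  rewrite !wE mulrA -exprS; congr (_ * _); rewrite /=.
  (* At i = 0 the predecessor is p-1, with exponent 0, and the cycle closes because xi^p = 1. *)
  case: i => -[|i] ip /=.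
    rewrite add0n modn_small ?prednK // subnn subn1 prednK //.
    by rewrite (prim_expr_order xi_prim) expr0.
  by rewrite modnDr modn_small ?(ltnW ip) // -subSn.
have tau_inv_T1 (i : 'I_n) : i = 0%N :> nat ->
    tau_inv (hecke_gen r_gt0 u q i) = xi^-1 *: hecke_gen r_gt0 u q i.
  by move=> i0; rewrite -[in RHS](tauK (hecke_gen _ _ _ i)) tau_T1 // linearZ /=
    scalerA mulVf // scale1r.
have tau_inv_T (i : 'I_n) : (0 < i)%N ->
    tau_inv (hecke_gen r_gt0 u q i) = hecke_gen r_gt0 u q i.
  by move=> i0; rewrite -[in LHS]tau_Ti // tauK.
apply: (@hecke_module_iso _ _ _ r_gt0 u q (twist tau_inv M) N _
         (vM \o @shift_std p d n lam) vN) => //.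
  exact/is_basis_twist/is_basis_reindex/shift_std_bij.
move=> f f_lin fv i t.
(* [f] is linear for the twisted action, while the formulas for the basis [vM] use the scalars of
   [M] itself. *)
have fZ (c : R[i]) (m : M) : f (c%:A *: m) = c%:A *: f m.
  by rewrite -(twist_algE tau_inv) (scalar_linearZ f_lin).
have -> : hecke_gen r_gt0 u q i *: (vM (shift_std t) : twist tau_inv M)
        = tau_inv (hecke_gen r_gt0 u q i) *: vM (shift_std t) by [].
have [i0|i_gt0] := posnP i.
  (* The factor xi in the shifted eigenvalue of T_1 cancels the xi^-1 coming from [tau_inv]. *)
  rewrite tau_inv_T1 // -mulr_algl -scalerA vM_T1 // vN_T1 //=.
  rewrite (component_shift w_shift) scalerA mulr_algl scalerA mulKf //.
  by rewrite fZ fv.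
(* The remaining generators are fixed by [tau_inv]; the seminormal formula needs the preceding index
   [x]. *)
have x_lt : (i.-1 < n)%N by rewrite (leq_ltn_trans (leq_pred i)).
pose x := Ordinal x_lt; have ix : i = x.+1 :> nat by rewrite /= prednK.
rewrite tau_inv_T // (vM_T _ _ _ ix) (vN_T _ _ _ ix) /=.
rewrite (diag_coef_shift _ xi_neq0 w_shift) swap_entries_shift.
rewrite oapp_insub_shift [LHS](scalar_linearD f_lin) !fZ fv; congr (_ + _ *: _).
by case: insub => [t'|] /=; rewrite ?fv ?(scalar_linear0 f_lin).
Qed.
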